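(* Let $A,U_J,U_K$ be nonempty sets, let $n\geqslant 3$ be an integer, and let $J\colon A^{n-1}\to U_J$ and $K\colon A^{n-1}\to U_K$ be functions. Assume that $\operatorname{ran}(J)=\operatorname{ran}(J_1^b)$ for some $b\in A$, and let $F\in\mathcal{F}_{J,K}$. Let $j\in Q(J_1^b)$ and let $S=S_j\colon A^n\to U_K$ be defined by $S(x_1,\ldots,x_n)=K(j(J(x_1,\ldots,x_{n-1})),x_n)$. Assume that $\operatorname{ran}(S)=\operatorname{ran}(\delta_S)$. Then the following assertions hold. (a) $F=\delta_F\circ s\circ S$ for every $s\in Q(\delta_S)$. (b) If $F'=f'\circ S$ satisfies $\delta_F=\delta_{F'}$ for some $f'\colon U_K\to\operatorname{ran}(F)$, then $F=F'$. (c) If $F$ is idempotent, then $F=s\circ S$ for every $s\in Q(\delta_S)$. (d) If $s\circ S$ is not idempotent for some $s\in Q(\delta_S)$, then $F$ is not idempotent. (e) For every $s\in Q(\delta_S)$, the function $s\circ S$ is range-idempotent (i.e., $s\circ\delta_S\circ s\circ S=s\circ S$). It is idempotent if and only if $\delta_S$ is one-to-one. Moreover, if $F\in\mathcal{F}^A_{J,K}$, then for every $s\in Q(\delta_S)$ we have $s\circ S\in\mathcal{F}^A_{J,K}$ if and only if $$\mathcal{F}^A_{J,K}=\{f\circ s\circ S\mid f\colon A\to A\}.$$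
   Context: For a function $h$, $\operatorname{dom}(h)$ and $\operatorname{ran}(h)$ denote its domain and range. Functions with the same domain and the same values are regarded as equal (codomains are disregarded when comparing functions or deciding class membership). $\mathcal{F}_{J,K}$ is the class of functions $F\colon A^n\to\operatorname{ran}(F)$ for which there exist $G\colon U_J\times A\to\operatorname{ran}(F)$ and $H\colon A\times U_K\to\operatorname{ran}(F)$ such that $F(x_1,\ldots,x_n)=G(J(x_1,\ldots,x_{n-1}),x_n)=H(x_1,K(x_2,\ldots,x_n))$ for all $x_1,\ldots,x_n\in A$. Also $\mathcal{F}^A_{J,K}=\{F\in\mathcal{F}_{J,K}\mid\operatorname{ran}(F)\subseteq A\}$. The section $J_1^b\colon A^{n-2}\to U_J$ is defined by $J_1^b(y)=J(b,y)$ for $y\in A^{n-2}$ (the first argument of $J$ is fixed to $b$). Since $j$ takes values in $A^{n-2}$, the expression $K(j(\cdot),x_n)$ means $K$ evaluated at the $(n-1)$-tuple obtained by putting $x_n$ after the components of $j(\cdot)$. The diagonal section of a function $F$ on $A^n$ is $\delta_F(x)=F(x,\ldots,x)$, $x\in A$. A function $F$ on $A^n$ is idempotent if $\delta_F(x)=x$ for all $x\in A$. A function $F\colon A^n\to A$ is range-idempotent if $\delta_F\circ F=F$. $Q(h)$ denotes the set of quasi-inverses of a function $h$: a function $g$ is a quasi-inverse of $h$ if $\operatorname{ran}(h)\subseteq\operatorname{dom}(g)$, $\operatorname{ran}(g)\subseteq\operatorname{dom}(h)$, $h\circ g|_{\operatorname{ran}(h)}=\mathrm{id}_{\operatorname{ran}(h)}$,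 and $\operatorname{ran}(g|_{\operatorname{ran}(h)})=\operatorname{ran}(g)$. The Axiom of Choice is assumed, so every function has a quasi-inverse. *)

(* Defs.v *)
From mathcomp Require Import all_boot.
From mathcomp Require Import boolp classical_sets.

Set Implicit Arguments.
Unset Strict Implicit.
Unset Printing Implicit Defensive.

Local Open Scope classical_set_scope.

(* [(x_1, ..., x_{n+1})] is sent to [(x_1, ..., x_n)] and to [x_{n+1}]. *)
Definition tinit (T : Type) (n : nat) (x : n.+1.-tuple T) : n.-tuple T :=
  [tuple tnth x (widen_ord (leqnSn n) i) | i < n].
Definition tlast (T : Type) (n : nat) (x : n.+1.-tuple T) : T :=
  tnth x ord_max.

(* A function with codomain [V] stands for the function onto its range: two
   functions into [V] are equal iff they have the same values, and the
   codomain constraints of the auxiliary functions are stated as range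
   inclusions. *)
Definition classF (A UJ UK V : Type) (n : nat)
    (J : n.+1.-tuple A -> UJ) (K : n.+1.-tuple A -> UK) :
    set (n.+2.-tuple A -> V) :=
  [set F | exists (G : UJ * A -> V) (H : A * UK -> V),
     [/\ range G `<=` range F, range H `<=` range F
       & forall x : n.+2.-tuple A,
           F x = G (J (tinit x), tlast x)
           /\ F x = H (thead x, K [tuple of behead x])]].

(* Here [A] is a subset of the ambient type [V] of values, so that values of
   [F] can be compared with elements of [A]. *)
Definition classFA (V UJ UK : Type) (A : set V) (n : nat)
    (J : n.+1.-tuple A -> UJ) (K : n.+1.-tuple A -> UK) :
    set (n.+2.-tuple A -> V) :=
  [set F | classF J K F /\ range F `<=` A].

Definition sect1 (A U : Type) (n : nat) (J : n.+1.-tuple A -> U) (b : A) :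
    n.-tuple A -> U :=
  fun y => J [tuple of b :: y].

Definition delta (A V : Type) (n : nat) (F : n.-tuple A -> V) : A -> V :=
  fun x => F [tuple of nseq n x].

Definition idempotentF (V : Type) (A : set V) (n : nat)
    (F : n.-tuple A -> V) : Prop :=
  forall x : A, delta F x = \val x.

Definition range_idempotentF (A : Type) (n : nat) (F : n.-tuple A -> A) : Prop :=
  delta F \o F = F.

(* A quasi-inverse is a partial function: it is encoded by its domain [D] and
   a function [g] whose values outside [D] are irrelevant.  Thus [g @` D] is
   its range, and the requirement that this range be contained in the domain
   of [h] is carried by the type of [g]. *)
Definition quasi_inverse (X Y : Type) (h : X -> Y) (D : set Y) (g : Y -> X) :
    Prop :=
  [/\ range h `<=` D,
      (forall y, range h y -> h (g y) = y)
    & g @` range h = g @` D].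

Definition Sfun (A UJ UK : Type) (n : nat)
    (J : n.+2.-tuple A -> UJ) (K : n.+2.-tuple A -> UK)
    (j : UJ -> n.+1.-tuple A) : n.+3.-tuple A -> UK :=
  fun x => K [tuple of rcons (j (J (tinit x))) (tlast x)].

(* Main.v *)
(* Every [F] in the class factors through [S]. As [ran S = ran delta_S], a
   function factoring through [S] is determined by its diagonal section. *)
Require Import Defs.
From mathcomp Require Import all_boot.
From mathcomp Require Import boolp classical_sets.

Local Open Scope classical_set_scope.

(** Since [j] inverts the section of [J] at [b], the first [n-1] arguments can be replaced by [b]
    and [j (J ...)], so each [F] in the class is [h \o S] ([classF_factor]). If [s] is a
    quasi-inverse of [delta S] and [S] has no values off the diagonal, then [delta S \o s \o S = S].
    Composing with [h] gives (a), because [delta (h \o S) = h \o delta S]; the other assertions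
    follow from these identities and from closure of the class under maps of [A]
    ([classFA_comp]). *)

Lemma tinit_rcons (T : Type) (n : nat) (u : n.-tuple T) (a : T) :
  tinit [tuple of rcons u a] = u.
Proof.
apply: eq_from_tnth => i.
by rewrite tnth_mktuple !(tnth_nth a) /= nth_rcons size_tuple ltn_ord.
Qed.

Lemma tlast_rcons (T : Type) (n : nat) (u : n.-tuple T) (a : T) :
  tlast [tuple of rcons u a] = a.
Proof. by rewrite /tlast (tnth_nth a) /= nth_rcons size_tuple ltnn eqxx. Qed.

Lemma tuple_cons_rcons (T : Type) (n : nat) (b a : T) (y : n.-tuple T) :
  [tuple of b :: [tuple of rcons y a]] =
  [tuple of rcons [tuple of b :: y] a] :> n.+2.-tuple T.
Proof. exact: val_inj. Qed.

(* The outer function is [H (b, -)]: replacing [x_1, ..., x_(n-1)] by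
   [b, j (J (x_1, ..., x_(n-1)))] does not change [J], hence not [F]. *)
Lemma classF_factor (A UJ UK V : Type) (m : nat)
    (J : m.+2.-tuple A -> UJ) (K : m.+2.-tuple A -> UK) (b : A)
    (Dj : set UJ) (j : UJ -> m.+1.-tuple A) (F : m.+3.-tuple A -> V) :
  range J = range (sect1 J b) -> quasi_inverse (sect1 J b) Dj j ->
  classF J K F ->
  exists h : UK -> V, F = h \o Sfun J K j.
Proof.
move=> ranJ [_ jK _] [G [H [_ _ FGH]]].
exists (fun u => H (b, u)); apply/funext => x.
have Jx : range (sect1 J b) (J (tinit x)) by rewrite -ranJ; exists (tinit x).
pose y := j (J (tinit x)).
have [FG FH] := FGH [tuple of b :: [tuple of rcons y (tlast x)]].
have Fx : F x = F [tuple of b :: [tuple of rcons y (tlast x)]].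
  rewrite FG tuple_cons_rcons tinit_rcons tlast_rcons.
  by rewrite [J _](jK _ Jx); case: (FGH x).
rewrite Fx FH /= theadE; congr (H (_, K _)); exact: val_inj.
Qed.

(** Extend [f] to a map of [V] and compose it with both [G] and [H]; their ranges lie in that of
    [g], so the range inclusions survive. *)
Lemma classFA_comp (V UJ UK : Type) (A : set V) (b : A) (n : nat)
    (J : n.+1.-tuple A -> UJ) (K : n.+1.-tuple A -> UK)
    (g : n.+2.-tuple A -> A) (f : A -> A) :
  classFA J K (\val \o g) -> classFA J K (\val \o f \o g).
Proof.
move=> [[G [H [rG rH FGH]]] _].
(* The default [b] only matters for arguments outside [A]. *)
pose phi v := \val (f (insubd b v)).
have phiK a : phi (\val a) = \val (f a) by rewrite /phi valKd.
split; last by move=> _ [x _ <-]; apply/set_mem/valP.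
exists (phi \o G), (phi \o H); split.
- move=> _ [p _ <-] /=; have [|x _ <-] := rG (G p); first by exists p.
  by exists x => //=; rewrite phiK.
- move=> _ [p _ <-] /=; have [|x _ <-] := rH (H p); first by exists p.
  by exists x => //=; rewrite phiK.
- by move=> x; have [/= <- <-] := FGH x; rewrite phiK.
Qed.

(* The arity is n = m.+3, with m : nat arbitrary, i.e. any integer n >= 3. *)
Theorem theorem16 (V UJ UK : Type) (A : set V)
    (A_nonempty : A !=set0) (UJ_nonempty : inhabited UJ)
    (UK_nonempty : inhabited UK)
    (m : nat) (J : m.+2.-tuple A -> UJ) (K : m.+2.-tuple A -> UK)
    (b : A) (ranJ : range J = range (sect1 J b))
    (F : m.+3.-tuple A -> V) (F_class : classF J K F)
    (Dj : set UJ) (j : UJ -> m.+1.-tuple A)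
    (j_qinv : quasi_inverse (sect1 J b) Dj j)
    (S : m.+3.-tuple A -> UK) (S_def : S = Sfun J K j)
    (ranS : range S = range (delta S)) :
  (* (a) *)
  (forall (D : set UK) (s : UK -> A), quasi_inverse (delta S) D s ->
     F = delta F \o s \o S)
  /\
  (* (b) *)
  (forall (F' : m.+3.-tuple A -> V) (f' : UK -> V),
     range f' `<=` range F -> F' = f' \o S -> delta F = delta F' -> F = F')
  /\
  (* (c) *)
  (idempotentF F ->
     forall (D : set UK) (s : UK -> A), quasi_inverse (delta S) D s ->
       F = \val \o s \o S)
  /\
  (* (d) *)
  ((exists (D : set UK) (s : UK -> A),
      quasi_inverse (delta S) D s /\ ~ idempotentF (\val \o s \o S)) ->
     ~ idempotentF F)
  /\
  (* (e) *)
  (forall (D : set UK) (s : UK -> A), quasi_inverse (delta S) D s ->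
     range_idempotentF (s \o S)
     /\ (idempotentF (\val \o s \o S) <-> injective (delta S)))
  /\
  (* final assertion *)
  (classFA J K F ->
     forall (D : set UK) (s : UK -> A), quasi_inverse (delta S) D s ->
       (classFA J K (\val \o s \o S)
        <-> classFA J K
            = [set F' | exists f : A -> A, F' = \val \o f \o s \o S])).
Proof.
have deltaS x : exists a, delta S a = S x.
  have : range (delta S) (S x) by rewrite -ranS; exists x.
  by case=> a _ <-; exists a.
have factorS E : classF J K E -> exists h : UK -> V, E = h \o S.
  by rewrite S_def; exact: (classF_factor _ _ _ _ _ _ _ _ _ _ _ ranJ j_qinv).
have sK D s : quasi_inverse (delta S) D s -> delta S \o s \o S = S.
  move=> [_ hs _]; apply/funext => x /=; apply: hs.
  by have [a <-] := deltaS x; exists a.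
have part_a (E : m.+3.-tuple A -> V) : classF J K E ->
    forall D s, quasi_inverse (delta S) D s -> E = delta E \o s \o S.
  move=> clE D s qs; have [h ->] := factorS E clE.
  (* By conversion, [delta (h \o S)] is [h \o delta S]. *)
  by rewrite -[in LHS](sK D s qs).
have part_c : idempotentF F -> forall D s, quasi_inverse (delta S) D s ->
    F = \val \o s \o S.
  move=> idF D s qs; rewrite (part_a F F_class D s qs).
  by apply/funext => x /=; rewrite idF.
split; first exact: part_a.
split.
  have [h ->] := factorS F F_class.
  move=> F' f' _ -> dFF'; apply/funext => x.
  by have [a /= <-] := deltaS x; exact: (congr1 (@^~ a) dFF').
split=> //.
split.
  by move=> [D [s [qs nid]]] idF; apply: nid; rewrite -(part_c idF D s qs).
split.
  move=> D s qs; split.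
    by rewrite /range_idempotentF -[in RHS](sK D s qs).
  split=> [ids x y dxy|injS x].
    (* Idempotence of [s \o S] makes [s] a left inverse of [delta S]. *)
    by apply: val_inj; rewrite -!ids /delta /=; congr (\val (s _)).
  have [_ hs _] := qs.
  (* [s (delta S x)] and [x] have the same image under [delta S]. *)
  by congr (\val _); exact: injS (hs _ (imageT (delta S) x)).
move=> _ D s qs; split=> [sS|->]; last by exists id.
apply/seteqP; split=> [E [clE rE]|_ [f ->]]; last first.
  exact: (classFA_comp _ _ _ _ b _ _ _ (s \o S)).
(* The required [f] is [delta E], corestricted to [A]; (a) for [E] then gives the equality. *)
have dE a : delta E a \in A by apply/mem_set/rE; exists [tuple of nseq m.+3 a].
exists (fun a => exist _ (delta E a) (dE a)).
exact: part_a qs.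
Qed.
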